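(* Let $X=Y=\mathbb R^d$, $\Omega=\mathbb R^d\times\mathbb R^d$, and let $\mu,\nu$ be Borel probability measures on $\mathbb R^d$ with finite first moments that are in convex order (i.e. $\int\phi\,d\mu\le\int\phi\,d\nu$ for all convex $\phi:\mathbb R^d\to\mathbb R$). Then $$\mathfrak H_{mot}=(\mathcal H_{mot}^\perp)^\perp=\mathfrak B_\ell+\mathfrak C_\ell+\mathfrak M .$$ In particular, the dual set $\mathfrak K_{mot}$ is the weak$^*$ closure of $\mathfrak B_\ell+\mathfrak C_\ell+\mathfrak M+(\mathcal C_\ell'')_-$.
   Context: Let $\ell_X(x)=1+|x|$, $\ell_Y(y)=1+|y|$, $\ell(x,y)=\ell_X(x)+\ell_Y(y)$. $\mathcal C_\ell$ is the Banach lattice of continuous $f:\Omega\to\mathbb R$ with $\|f\|_\ell=\sup_\Omega|f|/\ell<\infty$ (order unit $\ell$); $\mathcal C_X$ and $\mathcal C_Y$ are the analogous spaces of continuous functions on $X$, $Y$ with weights $\ell_X$, $\ell_Y$. Primes denote topological duals, ordered by duality; $(\cdot)_\pm$ denotes positive/negative elements; $\perp$ denotes the annihilator in the dual. Measures are identified with the functionals given by integration. The weak$^*$ topology on $\mathcal C_\ell''$ is $\sigma(\mathcal C_\ell'',\mathcal C_\ell')$. $(h\oplus g)(x,y)=h(x)+g(y)$. For $\eta\in\mathcal C_\ell'$: $\eta_x(h)=\eta(h\oplus\mathbf 0)$ for $h\in\mathcal C_X$, $\eta_y(g)=\eta(\mathbf 0\oplus g)$ for $g\in\mathcal C_Y$;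 for $\mathfrak b\in\mathcal C_X''$, $\mathfrak c\in\mathcal C_Y''$: $(\mathfrak b\oplus\mathfrak c)(\eta)=\mathfrak b(\eta_x)+\mathfrak c(\eta_y)$. $T:C_b(X;\mathbb R^d)\to\mathcal C_\ell$ is $T(\gamma)(x,y)=\gamma(x)\cdot(x-y)$. $\mathcal M=\{\eta\in\mathcal C_\ell':\eta(T(\gamma))=0\ \forall\gamma\in C_b(X;\mathbb R^d)\}$ and $\mathfrak M=\mathcal M^\perp\subset\mathcal C_\ell''$. $\mathcal H_{mot}=\{h\oplus g+T(\gamma):h\in\mathcal C_X,\ g\in\mathcal C_Y,\ \mu(h)=\nu(g)=0,\ \gamma\in C_b(X;\mathbb R^d)\}$. $\hat{\mathcal Q}_{mot}=\mathcal H_{mot}^\perp\cap\{\eta\in(\mathcal C_\ell')_+:\eta(\ell)=1\}$ and $\mathfrak K_{mot}=\{\mathfrak z\in\mathcal C_\ell'':\mathfrak z(\eta)\le0\ \forall\eta\in\hat{\mathcal Q}_{mot}\}$. $\mathfrak B_\ell=\{\mathfrak b\oplus\mathbf 0:\mathfrak b\in\mathcal C_X'',\ \mathfrak b(\mu)=0\}$ and $\mathfrak C_\ell=\{\mathbf 0\oplus\mathfrak c:\mathfrak c\in\mathcal C_Y'',\ \mathfrak c(\nu)=0\}$. *)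

(* Defs.v *)
From HB Require Import structures.
From mathcomp Require Import all_boot all_order all_algebra.
From mathcomp Require Import all_classical all_reals all_analysis.
From mathcomp Require Import measurable_realfun.

Set Implicit Arguments.
Unset Strict Implicit.
Unset Printing Implicit Defensive.

Import Order.TTheory GRing.Theory Num.Theory.
Import numFieldNormedType.Exports.

Local Open Scope classical_set_scope.
Local Open Scope ring_scope.

Section sup_norm.
Context {R : realType} {I : Type}.
Implicit Types (f : I -> R) (A : set I).

Lemma sup_image_ub f A M x : (forall y, A y -> f y <= M) -> A x ->
  f x <= sup (f @` A).
Proof.
move=> fM Ax; apply: ub_le_sup; last by exists x.
by exists M => _ [y Ay <-]; exact: fM.
Qed.

Lemma sup_image_le f A M : 0 <= M -> (forall y, A y -> f y <= M) ->
  sup (f @` A) <= M.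
Proof.
move=> M0 fM; have [->|/set0P A0] := eqVneq (f @` A) set0; first by rewrite sup0.
by apply: ge_sup => // _ [y Ay <-]; exact: fM.
Qed.

End sup_norm.

Section dual_space.
Context {R : realType} (V : normedModType R).

Definition dual_pred : {pred V -> R} :=
  mem [set f : V -> R | linear f /\ continuous f].

Record dual := Dual { dual_fun :> V -> R ; dual_funP : dual_fun \in dual_pred }.

HB.instance Definition _ := [isSub for dual_fun].
HB.instance Definition _ := [Choice of dual by <:].

Lemma dual_submod_closed : submod_closed dual_pred.
Proof.
split; first rewrite inE /=.
  split; first by move=> k x y; rewrite scaler0 addr0.
  exact: cst_continuous.
move=> k f g; rewrite !inE /= => -[lf cf] [lg cg]; split.
  move=> a x y; rewrite !fctE lf lg /GRing.scale /=.
  by rewrite !mulrDr addrACA mulrCA.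
by move=> x; apply: cvgD; [apply: cvgZl_tmp; exact: cf|exact: cg].
Qed.

HB.instance Definition _ :=
  GRing.isSubmodClosed.Build _ _ dual_pred dual_submod_closed.
HB.instance Definition _ := [SubChoice_isSubLmodule of dual by <:].

Lemma dual_linear (f : dual) : linear f.
Proof. by have := dual_funP f; rewrite inE => -[]. Qed.

Lemma dual_continuous (f : dual) : continuous f.
Proof. by have := dual_funP f; rewrite inE => -[]. Qed.

HB.instance Definition _ (f : dual) :=
  GRing.isLinear.Build R V R *:%R f (dual_linear f).

Definition dual_norm (f : dual) : R :=
  sup [set `|f x| | x in [set x : V | `|x| <= 1]].

Lemma dual_bounded (f : dual) : exists2 M, 0 < M & forall x, `|f x| <= M * `|x|.
Proof.
have /linear_bounded_continuous/linear_boundedP := @dual_continuous f.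
by move=> /pinfty_ex_gt0.
Qed.

Lemma dual_norm_ge0 (f : dual) : 0 <= dual_norm f.
Proof.
have [M M0 fM] := dual_bounded f.
rewrite (le_trans (normr_ge0 (f 0)))//.
apply: (@sup_image_ub _ _ (fun x => `|f x|) _ M); last by rewrite /= normr0.
by move=> y /= y1; rewrite (le_trans (fM _))// ler_piMr// ltW.
Qed.

Lemma dual_norm_le (f : dual) x : `|f x| <= dual_norm f * `|x|.
Proof.
have [M M0 fM] := dual_bounded f.
have [->|x0] := eqVneq x 0; first by rewrite linear0 !normr0 mulr0.
have nx0 : 0 < `|x| by rewrite normr_gt0.
rewrite -ler_pdivrMr// -[leLHS]/(_ * _) mulrC.
have -> : `|x|^-1 * `|f x| = `|f (`|x|^-1 *: x)|.
  by rewrite linearZ /= normrM normfV normr_id.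
apply: (@sup_image_ub _ _ (fun x => `|f x|) _ M).
  by move=> y /= y1; rewrite (le_trans (fM _))// ler_piMr// ltW.
by rewrite /= normrZ normfV normr_id mulVf// gt_eqF.
Qed.

Lemma dual_norm_leP (f : dual) M : 0 <= M -> (forall x, `|f x| <= M * `|x|) ->
  dual_norm f <= M.
Proof.
move=> M0 fM; apply: (@sup_image_le _ _ (fun x => `|f x|)) => // y /= y1.
by rewrite (le_trans (fM _))// ler_piMr.
Qed.

Lemma dual_normD (f g : dual) : dual_norm (f + g) <= dual_norm f + dual_norm g.
Proof.
apply: dual_norm_leP; first by rewrite addr_ge0// dual_norm_ge0.
move=> x; rewrite mulrDl (le_trans (ler_normD _ _))//.
by rewrite lerD// dual_norm_le.
Qed.

Lemma dual_normZle (k : R) (f : dual) : dual_norm (k *: f) <= `|k| * dual_norm f.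
Proof.
apply: dual_norm_leP; first by rewrite mulr_ge0// dual_norm_ge0.
move=> x; rewrite -mulrA [X in X <= _](_ : _ = `|k| * `|f x|); last exact: normrM.
by rewrite ler_wpM2l// dual_norm_le.
Qed.

Lemma dual_normZ (k : R) (f : dual) : dual_norm (k *: f) = `|k| * dual_norm f.
Proof.
apply/eqP; rewrite eq_le dual_normZle /=.
have [->|k0] := eqVneq k 0; first by rewrite normr0 mul0r dual_norm_ge0.
rewrite -ler_pdivlMl ?normr_gt0// -normfV.
by have := dual_normZle k^-1 (k *: f); rewrite scalerA mulVf// scale1r.
Qed.

Lemma dual_norm0_eq0 (f : dual) : dual_norm f = 0 -> f = 0.
Proof.
move=> f0; apply/val_inj/funext => x; apply/eqP.
by rewrite -normr_le0 (le_trans (dual_norm_le _ _))// f0 mul0r.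
Qed.

HB.instance Definition _ :=
  Lmodule_isNormed.Build R dual dual_normD dual_normZ dual_norm0_eq0.

Section make.
Variables (f : V -> R) (lf : linear f) (M : R).
Hypothesis fM : forall x, `|f x| <= M * `|x|.

Lemma mk_dual_subproof : f \in dual_pred.
Proof.
rewrite inE /=; split => //.
pose g := HB.pack_for {linear V -> R} f (GRing.isLinear.Build R V R *:%R f lf).
apply/(linear_bounded_continuous g)/linear_boundedP; near=> r => x.
rewrite (le_trans (fM x))// ler_wpM2r//.
Unshelve. all: by end_near. Qed.

Definition mk_dual : dual := Dual mk_dual_subproof.

End make.

Definition annihilator (A : set V) : set dual :=
  [set f | forall x, A x -> f x = 0].

(* [P] is the set of nonnegative elements of [V]. *)
Definition dual_nonneg (P : set V) : set dual :=
  [set f | forall x, P x -> 0 <= f x].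
Definition dual_nonpos (P : set V) : set dual :=
  [set f | forall x, P x -> f x <= 0].

(* The topology sigma(V', V), i.e. the one induced by the product topology of
   R^V, and not the norm topology carried by [dual]. *)
Definition weak_star_dual : Type :=
  initial_topology (fun f : dual => (f : V -> R) : {ptws V -> R}).
HB.instance Definition _ := Topological.on weak_star_dual.

Definition weak_star_closure (A : set dual) : set dual :=
  closure (A : set weak_star_dual).

End dual_space.

Definition minkowski_sum {V : zmodType} (A B : set V) : set V :=
  [set a + b | a in A & b in B].

Record weight (R : realType) (T : topologicalType) := Weight {
  weight_fun :> T -> R ;
  weight_gt0 : forall x, 0 < weight_fun x ;
  weight_continuous : continuous weight_fun }.

Section weighted_continuous.
Context {R : realType} {T : topologicalType} (w : weight R T).

Definition Cw_pred : {pred T -> R} := mem [set f : T -> R |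
  continuous f /\ has_ubound (range (fun x => `|f x| / w x))].

Record Cw := CW { Cw_fun :> T -> R ; Cw_funP : Cw_fun \in Cw_pred }.

HB.instance Definition _ := [isSub for Cw_fun].
HB.instance Definition _ := [Choice of Cw by <:].

Lemma Cw_predP (f : T -> R) : f \in Cw_pred <->
  continuous f /\ exists2 M, 0 <= M & forall x, `|f x| <= M * w x.
Proof.
rewrite inE /=; split=> -[cf].
  move=> [M fM]; split => //; exists `|M| => // x.
  rewrite -ler_pdivrMr ?weight_gt0// (le_trans _ (ler_norm _))//.
  by apply: fM; exists x.
move=> [M M0 fM]; split=> //; exists M => _ [x _ <-].
by rewrite ler_pdivrMr ?weight_gt0.
Qed.

Lemma Cw_submod_closed : submod_closed Cw_pred.
Proof.
split.
  apply/Cw_predP; split; first exact: cst_continuous.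
  by exists 0 => // x; rewrite normr0 mul0r.
move=> k f g /Cw_predP[cf [M M0 fM]] /Cw_predP[cg [N N0 gN]].
apply/Cw_predP; split.
  by move=> x; apply: cvgD; [apply: cvgZl_tmp; exact: cf|exact: cg].
exists (`|k| * M + N); first by rewrite addr_ge0// mulr_ge0.
move=> x; rewrite (le_trans (ler_normD _ _))// mulrDl lerD//.
by rewrite [leLHS](_ : _ = `|k| * `|f x|) ?normrM// -mulrA ler_wpM2l.
Qed.

HB.instance Definition _ :=
  GRing.isSubmodClosed.Build _ _ Cw_pred Cw_submod_closed.
HB.instance Definition _ := [SubChoice_isSubLmodule of Cw by <:].

Definition Cw_norm (f : Cw) : R := sup (range (fun x => `|f x| / w x)).

Lemma Cw_continuous (f : Cw) : continuous f.
Proof. by have /Cw_predP[] := Cw_funP f. Qed.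

Lemma Cw_norm_le (f : Cw) x : `|f x| <= Cw_norm f * w x.
Proof.
have /Cw_predP[_ [M M0 fM]] := Cw_funP f.
rewrite -ler_pdivrMr ?weight_gt0//.
apply: (@sup_image_ub _ _ (fun x => `|f x| / w x) _ M) => // y _.
by rewrite ler_pdivrMr ?weight_gt0.
Qed.

Lemma Cw_norm_leP (f : Cw) M : 0 <= M -> (forall x, `|f x| <= M * w x) ->
  Cw_norm f <= M.
Proof.
move=> M0 fM; apply: (@sup_image_le _ _ (fun x => `|f x| / w x)) => // y _.
by rewrite ler_pdivrMr ?weight_gt0.
Qed.

Lemma Cw_norm_ge0 (f : Cw) : 0 <= Cw_norm f.
Proof.
have [T0|/set0P[x _]] := eqVneq [set: T] set0.
  by rewrite /Cw_norm T0 image_set0 sup0.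
by rewrite -(pmulr_lge0 _ (weight_gt0 w x)) (le_trans _ (Cw_norm_le f x)).
Qed.

Lemma Cw_normD (f g : Cw) : Cw_norm (f + g) <= Cw_norm f + Cw_norm g.
Proof.
apply: Cw_norm_leP; first by rewrite addr_ge0// Cw_norm_ge0.
move=> x; rewrite mulrDl (le_trans (ler_normD _ _))//.
by rewrite lerD// Cw_norm_le.
Qed.

Lemma Cw_normZle (k : R) (f : Cw) : Cw_norm (k *: f) <= `|k| * Cw_norm f.
Proof.
apply: Cw_norm_leP; first by rewrite mulr_ge0// Cw_norm_ge0.
move=> x; rewrite -mulrA [X in X <= _](_ : _ = `|k| * `|f x|); last exact: normrM.
by rewrite ler_wpM2l// Cw_norm_le.
Qed.

Lemma Cw_normZ (k : R) (f : Cw) : Cw_norm (k *: f) = `|k| * Cw_norm f.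
Proof.
apply/eqP; rewrite eq_le Cw_normZle /=.
have [->|k0] := eqVneq k 0; first by rewrite normr0 mul0r Cw_norm_ge0.
rewrite -ler_pdivlMl ?normr_gt0// -normfV.
by have := Cw_normZle k^-1 (k *: f); rewrite scalerA mulVf// scale1r.
Qed.

Lemma Cw_norm0_eq0 (f : Cw) : Cw_norm f = 0 -> f = 0.
Proof.
move=> f0; apply/val_inj/funext => x; apply/eqP.
by rewrite -normr_le0 (le_trans (Cw_norm_le _ _))// f0 mul0r.
Qed.

HB.instance Definition _ :=
  Lmodule_isNormed.Build R Cw Cw_normD Cw_normZ Cw_norm0_eq0.

Section make.
Variables (f : T -> R) (cf : continuous f) (M : R) (M0 : 0 <= M).
Hypothesis fM : forall x, `|f x| <= M * w x.

Lemma mk_Cw_subproof : f \in Cw_pred.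
Proof. by apply/Cw_predP; split => //; exists M. Qed.

Definition mk_Cw : Cw := CW mk_Cw_subproof.

End make.

Lemma weight_le1 x : `|w x| <= 1 * w x.
Proof. by rewrite mul1r gtr0_norm// weight_gt0. Qed.

Definition Cw_unit : Cw := mk_Cw (@weight_continuous _ _ w) ler01 weight_le1.

Definition Cw_nonneg : set Cw := [set f | forall x, 0 <= f x].

End weighted_continuous.

Section direct_sum.
Context {R : realType} {X Y : topologicalType}.
Variables (wX : weight R X) (wY : weight R Y).

Lemma weight_sum_gt0 (p : X * Y) : 0 < wX p.1 + wY p.2.
Proof. by rewrite addr_gt0// weight_gt0. Qed.

Lemma continuous_sum (h : X -> R) (g : Y -> R) : continuous h -> continuous g ->
  continuous (fun p : X * Y => h p.1 + g p.2).
Proof.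
move=> ch cg p; apply: cvgD.
  by apply: (@cvg_comp _ _ _ fst h _ (nbhs p.1)); [exact: cvg_fst|exact: ch].
by apply: (@cvg_comp _ _ _ snd g _ (nbhs p.2)); [exact: cvg_snd|exact: cg].
Qed.

Definition weight_sum : weight R (X * Y)%type :=
  Weight weight_sum_gt0
    (continuous_sum (@weight_continuous _ _ wX) (@weight_continuous _ _ wY)).

Lemma oplus_bounded (h : Cw wX) (g : Cw wY) (p : X * Y) :
  `|h p.1 + g p.2| <= (`|h| + `|g|) * weight_sum p.
Proof.
rewrite (le_trans (ler_normD _ _))// [leRHS]mulrDr lerD//.
  rewrite (le_trans (Cw_norm_le _ _))// ler_wpM2r ?lerDl//.
  by rewrite ltW// weight_gt0.
rewrite (le_trans (Cw_norm_le _ _))// ler_wpM2r ?lerDr//.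
by rewrite ltW// weight_gt0.
Qed.

Lemma oplus_bound_ge0 (h : Cw wX) (g : Cw wY) : 0 <= `|h| + `|g|.
Proof. by rewrite addr_ge0. Qed.

Definition oplus (h : Cw wX) (g : Cw wY) : Cw weight_sum :=
  mk_Cw (continuous_sum (@Cw_continuous _ _ _ h) (@Cw_continuous _ _ _ g))
    (oplus_bound_ge0 h g) (oplus_bounded h g).

Lemma oplus_norm (h : Cw wX) (g : Cw wY) : `|oplus h g| <= `|h| + `|g|.
Proof. by apply: Cw_norm_leP => //; exact: oplus_bounded. Qed.

Lemma marginX_linear (eta : dual (Cw weight_sum)) :
  linear (fun h : Cw wX => eta (oplus h 0)).
Proof.
move=> k h h'; rewrite -[RHS]dual_linear; congr (eta _).
apply/val_inj/funext => p.
change ((k * h p.1 + h' p.1) + 0 = k * (h p.1 + 0) + (h' p.1 + 0)).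
by rewrite !addr0.
Qed.

Lemma marginX_bounded (eta : dual (Cw weight_sum)) (h : Cw wX) :
  `|eta (oplus h 0)| <= `|eta| * `|h|.
Proof.
rewrite (le_trans (dual_norm_le _ _))// ler_wpM2l ?dual_norm_ge0//.
by rewrite (le_trans (oplus_norm _ _))// normr0 addr0.
Qed.

(* The functional eta_x, and eta_y in [marginY]. *)
Definition marginX (eta : dual (Cw weight_sum)) : dual (Cw wX) :=
  mk_dual (marginX_linear eta) (marginX_bounded eta).

Lemma marginY_linear (eta : dual (Cw weight_sum)) :
  linear (fun g : Cw wY => eta (oplus 0 g)).
Proof.
move=> k g g'; rewrite -[RHS]dual_linear; congr (eta _).
apply/val_inj/funext => p.
change (0 + (k * g p.2 + g' p.2) = k * (0 + g p.2) + (0 + g' p.2)).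
by rewrite !add0r.
Qed.

Lemma marginY_bounded (eta : dual (Cw weight_sum)) (g : Cw wY) :
  `|eta (oplus 0 g)| <= `|eta| * `|g|.
Proof.
rewrite (le_trans (dual_norm_le _ _))// ler_wpM2l ?dual_norm_ge0//.
by rewrite (le_trans (oplus_norm _ _))// normr0 add0r.
Qed.

Definition marginY (eta : dual (Cw weight_sum)) : dual (Cw wY) :=
  mk_dual (marginY_linear eta) (marginY_bounded eta).

Section bidual.
Variables (b : dual (dual (Cw wX))) (c : dual (dual (Cw wY))).

Lemma bioplus_linear :
  linear (fun eta : dual (Cw weight_sum) => b (marginX eta) + c (marginY eta)).
Proof.
move=> k eta eta'.
have -> : marginX (k *: eta + eta') = k *: marginX eta + marginX eta'.
  exact/val_inj/funext.
have -> : marginY (k *: eta + eta') = k *: marginY eta + marginY eta'.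
  exact/val_inj/funext.
by rewrite !dual_linear scalerDr addrACA.
Qed.

Lemma bioplus_bounded (eta : dual (Cw weight_sum)) :
  `|b (marginX eta) + c (marginY eta)| <= (`|b| + `|c|) * `|eta|.
Proof.
rewrite (le_trans (ler_normD _ _))// mulrDl lerD//.
  rewrite (le_trans (dual_norm_le _ _))// ler_wpM2l ?dual_norm_ge0//.
  by apply: dual_norm_leP => // h; exact: marginX_bounded.
rewrite (le_trans (dual_norm_le _ _))// ler_wpM2l ?dual_norm_ge0//.
by apply: dual_norm_leP => // h; exact: marginY_bounded.
Qed.

(* The direct sum of functionals on the duals of C_X and C_Y, as opposed to
   the direct sum [oplus] of functions. *)
Definition bioplus : dual (dual (Cw weight_sum)) :=
  mk_dual bioplus_linear bioplus_bounded.

End bidual.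

End direct_sum.

Definition borel_type (T : ptopologicalType) := g_sigma_algebraType (@open T).

Section integral_functional.
Context {R : realType} {T : ptopologicalType}.
Variables (m : {measure set (borel_type T) -> \bar R}) (w : weight R T).

Lemma continuous_borel_measurable (f : T -> R) : continuous f ->
  measurable_fun [set: borel_type T] (f : borel_type T -> R).
Proof.
move=> cf; apply: (measurability _ (RGenOpens.measurableE R)).
move=> _ [_ [a [b ->] <-]]; rewrite setTI; apply: sub_sigma_algebra.
by apply: open_comp => [x _|]; [exact: cf|exact: interval_open].
Qed.

Hypothesis mw : m.-integrable [set: borel_type T] (EFin \o (w : borel_type T -> R)).

Lemma Cw_integrable (f : Cw w) :
  m.-integrable [set: borel_type T] (EFin \o (f : borel_type T -> R)).
Proof.
apply: (@le_integrable _ _ _ m _ _ _ (fun x => `|f|%:E * (EFin \o w) x)%E) => //.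
- apply/measurable_EFinP; apply: continuous_borel_measurable.
  exact: Cw_continuous.
- move=> x _; rewrite [leLHS]/= [leRHS]/= lee_fin.
  by rewrite (le_trans (Cw_norm_le _ _))// ler_norm.
- exact: integrableZl.
Qed.

Lemma integral_linear :
  linear (fun f : Cw w => \int[m]_(x in [set: borel_type T]) f x).
Proof.
move=> k f g.
rewrite -[LHS]/(\int[m]_(x in [set: borel_type T]) (k * f x + g x)).
rewrite RintegralD//; last 2 first.
- exact: (integrableZl measurableT k (Cw_integrable f)).
- exact: Cw_integrable.
by rewrite RintegralZl//; exact: Cw_integrable.
Qed.

Lemma integral_bounded (f : Cw w) :
  `|\int[m]_(x in [set: borel_type T]) f x| <=
  (\int[m]_(x in [set: borel_type T]) w x) * `|f|.
Proof.
rewrite (le_trans (le_normr_Rintegral _ (Cw_integrable f)))//.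
rewrite mulrC -RintegralZl//; apply: le_Rintegral => //.
- exact/integrable_norm/Cw_integrable.
- exact: (integrableZl measurableT _ mw).
- by move=> x _; exact: Cw_norm_le.
Qed.

Definition integral_functional : dual (Cw w) :=
  mk_dual integral_linear integral_bounded.

End integral_functional.

Lemma sum_continuous {R : realType} (U : topologicalType) n (f : 'I_n -> U -> R) :
  (forall i, continuous (f i)) -> continuous (fun x => \sum_i f i x).
Proof.
move=> cf; elim: n f cf => [|n IHn] f cf x.
  by under eq_fun do rewrite big_ord0; exact: cvg_cst.
under eq_fun do rewrite big_ord_recr /=.
by apply: cvgD; [exact: (IHn (fun i => f (widen_ord (leqnSn n) i)))|exact: cf].
Qed.

Section martingale_transport.
Context {R : realType} {d : nat}.
Local Notation E := 'rV[R]_d.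

Definition dotp (x y : E) : R := \sum_i x ord0 i * y ord0 i.

Definition enorm (x : E) : R := Num.sqrt (dotp x x).

Lemma enorm_continuous : continuous enorm.
Proof.
move=> x; apply: continuous_comp; last exact: sqrt_continuous.
apply: sum_continuous => i y.
by apply: (@cvgM R _ (nbhs y)); exact: coord_continuous.
Qed.

Lemma coord_enorm (x : E) i : `|x ord0 i| <= enorm x.
Proof.
rewrite -sqrtr_sqr ler_sqrt; last first.
  by apply: sumr_ge0 => j _; rewrite -expr2 sqr_ge0.
rewrite /dotp (bigD1 i)//= -expr2 lerDl.
by apply: sumr_ge0 => j _; rewrite -expr2 sqr_ge0.
Qed.

Lemma ell1_gt0 (x : E) : 0 < 1 + enorm x.
Proof. by rewrite ltr_pwDl// sqrtr_ge0. Qed.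

Lemma ell1_continuous : continuous (fun x : E => 1 + enorm x).
Proof.
move=> x; apply: (@cvgD _ _ _ (nbhs x)); first exact: cvg_cst.
exact: enorm_continuous.
Qed.

(* Since X = Y, the weights l_X and l_Y coincide. *)
Definition ell1 : weight R E := Weight ell1_gt0 ell1_continuous.

Definition ell : weight R (E * E)%type := weight_sum ell1 ell1.

Record Cb := MkCb {
  Cb_fun :> E -> E ;
  Cb_continuous : continuous Cb_fun ;
  Cb_bounded : bounded_fun Cb_fun }.

Section T_operator.
Variable gamma : Cb.

Lemma T_continuous : continuous (fun p : E * E => dotp (gamma p.1) (p.1 - p.2)).
Proof.
apply: sum_continuous => i p; apply: (@cvgM R _ (nbhs p)).
  apply: (@cvg_comp _ _ _ fst (fun x => gamma x ord0 i) _ (nbhs p.1)).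
    exact: cvg_fst.
  apply: (@continuous_comp _ _ _ gamma (fun x : E => x ord0 i)).
    exact: Cb_continuous.
  exact: coord_continuous.
apply: (@continuous_comp _ _ _ (fun p : E * E => p.1 - p.2)
   (fun x : E => x ord0 i)); last exact: coord_continuous.
by apply: (@cvgB _ _ _ (nbhs p)); [exact: cvg_fst|exact: cvg_snd].
Qed.

Lemma T_bounded : exists M, 0 <= M /\
  forall p : E * E, `|dotp (gamma p.1) (p.1 - p.2)| <= M * ell p.
Proof.
have /pinfty_ex_gt0[M M0 gM] := Cb_bounded gamma.
exists (M *+ d); split; first by rewrite mulrn_wge0// ltW.
move=> p; rewrite (le_trans (ler_norm_sum _ _ _))//.
have -> : M *+ d * ell p = \sum_(i < d) M * ell p.
  by rewrite sumr_const card_ord mulrnAl.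
apply: ler_sum => i _; rewrite normrM ler_pM//.
  rewrite (le_trans _ (gM p.1 _))// [leRHS]mx_normrE.
  exact: (le_bigmax _ (fun ij => `|gamma p.1 ij.1 ij.2|) (ord0, i)).
rewrite !mxE (le_trans (ler_normB _ _))//.
rewrite /ell /= lerD// (le_trans (coord_enorm _ _))// lerDr//.
Qed.

Definition Tmot : Cw ell :=
  mk_Cw T_continuous (proj1 (projT2 (cid T_bounded)))
    (proj2 (projT2 (cid T_bounded))).

End T_operator.

(* The calligraphic M of continuous functionals, of which [frakM] is the
   annihilator. *)
Definition mart_null : set (dual (Cw ell)) :=
  [set eta | forall gamma : Cb, eta (Tmot gamma) = 0].

Definition frakM : set (dual (dual (Cw ell))) := annihilator mart_null.

Definition finite_first_moment (mu : probability (borel_type E) R) : Prop :=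
  mu.-integrable [set: borel_type E] (fun x => (enorm x)%:E).

(* The integrals are extended real: [phi] has an affine minorant, hence an
   integrable negative part when the first moments are finite, but its integral
   may be +oo. *)
Definition convex_order (mu nu : probability (borel_type E) R) : Prop :=
  forall phi : E -> R, convex_function [set: E] phi ->
    (\int[mu]_(x in [set: borel_type E]) (phi x)%:E <=
     \int[nu]_(x in [set: borel_type E]) (phi x)%:E)%E.

Lemma ell1_integrable (mu : probability (borel_type E) R) :
  finite_first_moment mu ->
  mu.-integrable [set: borel_type E] (EFin \o (ell1 : borel_type E -> R)).
Proof.
move=> imu.
have i1 := finite_measure_integrable_cst mu (1 : R) measurableT.
exact: (integrableD measurableT i1 imu).
Qed.

Definition moment_functional (mu : probability (borel_type E) R)
    (imu : finite_first_moment mu) : dual (Cw ell1) :=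
  integral_functional (ell1_integrable imu).

Section problem.
Variables (mu nu : probability (borel_type E) R).

Definition Hmot : set (Cw ell) :=
  [set f | exists (h g : Cw ell1) (gamma : Cb),
    [/\ \int[mu]_(x in [set: borel_type E]) h x = 0,
        \int[nu]_(y in [set: borel_type E]) g y = 0 &
        f = oplus h g + Tmot gamma]].

Definition frakHmot : set (dual (dual (Cw ell))) :=
  annihilator (annihilator Hmot).

Definition Qhat_mot : set (dual (Cw ell)) :=
  annihilator Hmot `&`
  [set eta | dual_nonneg (@Cw_nonneg _ _ ell) eta /\ eta (Cw_unit ell) = 1].

Definition frakKmot : set (dual (dual (Cw ell))) :=
  [set z | forall eta, Qhat_mot eta -> z eta <= 0].

Hypotheses (imu : finite_first_moment mu) (inu : finite_first_moment nu).

Definition frakB : set (dual (dual (Cw ell))) :=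
  [set bioplus b 0 | b in [set b : dual (dual (Cw ell1)) |
                            b (moment_functional imu) = 0]].

Definition frakC : set (dual (dual (Cw ell))) :=
  [set bioplus 0 c | c in [set c : dual (dual (Cw ell1)) |
                            c (moment_functional inu) = 0]].

End problem.

Definition bidual_nonpos : set (dual (dual (Cw ell))) :=
  dual_nonpos (dual_nonneg (@Cw_nonneg _ _ ell)).

End martingale_transport.

(* Main.v *)
Require Import Defs.
From mathcomp Require Import all_boot all_order all_algebra.
From mathcomp Require Import all_classical all_reals all_analysis.
From mathcomp Require Import ring lra.
Import numFieldNormedType.Exports.

(**
The annihilator N of H_mot consists of the martingale functionals eta whose
marginals are multiples of mu and nu.  The point is that marginals can be
prescribed, by an explicit bounded linear formula.  For functionals a and b on
the weighted space over R^d, put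

  [coupling a b] : f |-> a (x |-> f (x, x)) + (b - a) (y |-> f (0, y)).

The first term is carried by the diagonal, where T(gamma) vanishes; it has both
marginals equal to a.  The second term is carried by {0} x R^d, where T(gamma)
is the linear function y |-> - gamma(0) . y, and there a function of x alone is
constant.  Hence, as soon as a and b agree on affine functions, the coupling
kills every T(gamma) and has marginals a and b ([coupling_mart_null],
[marginX_coupling], [marginY_coupling]).  The marginals of a martingale
functional do agree on affine functions ([mart_null_agree]).

Let z vanish on N.  For a martingale functional eta, the difference between eta
and the coupling of its marginals has zero marginals, so it lies in N, and
z(eta) = z(coupling eta_x eta_y) is the sum of a bounded linear function of
eta_x and one of eta_y.  This writes z as b0 (+) c0 modulo the annihilator of
the martingale functionals.  Convex order says, on affine functions, that mu
and nu have the same barycentre; so coupling mu nu is in N and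
b0(mu) + c0(nu) = 0.  Moving a multiple of the total mass from b0 to c0, which
does not change b0 (+) c0 on martingale functionals, makes both terms vanish
([frakHmot_sumBCM]).

The second assertion is a bipolar theorem for cones in the weak* topology
([weak_star_bipolar]), which reduces to the separation of a point from a convex
cone in R^n, because weak* neighbourhoods only involve finitely many
coordinates.  A predual element eta that is nonpositive on
N^perp + (C_l'')_- is tested against evaluations at elements of H_mot and at
nonpositive functions: it lies in N and is nonnegative.  Either it vanishes or
a positive multiple of it belongs to the normalized set that defines K_mot.
*)

Set Implicit Arguments.
Unset Strict Implicit.
Unset Printing Implicit Defensive.

Import Order.TTheory GRing.Theory Num.Theory.

Local Open Scope classical_set_scope.
Local Open Scope ring_scope.

(** * Separation of a point from a convex cone in R^n *)

Section separation.
Context {R : realType}.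

Lemma dotpC n (x y : 'rV[R]_n) : dotp x y = dotp y x.
Proof. by apply: eq_bigr => i _; rewrite mulrC. Qed.

Lemma dotpDr n (x y z : 'rV[R]_n) : dotp x (y + z) = dotp x y + dotp x z.
Proof. by rewrite -big_split; apply: eq_bigr => i _; rewrite mxE mulrDr. Qed.

Lemma dotpZr n (k : R) (x y : 'rV[R]_n) : dotp x (k *: y) = k * dotp x y.
Proof. by rewrite mulr_sumr; apply: eq_bigr => i _; rewrite mxE mulrCA. Qed.

Lemma dotpNr n (x y : 'rV[R]_n) : dotp x (- y) = - dotp x y.
Proof. by rewrite -scaleN1r dotpZr mulN1r. Qed.

Lemma dotp_subZ n (t : R) (x y : 'rV[R]_n) :
  dotp (x - t *: y) (x - t *: y) =
  dotp x x - 2 * t * dotp x y + t ^+ 2 * dotp y y.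
Proof.
rewrite dotpDr dotpNr dotpZr !(dotpC (x - _)) !dotpDr !dotpNr !dotpZr.
by rewrite (dotpC y x); ring.
Qed.

Lemma dotp_ge0 n (x : 'rV[R]_n) : 0 <= dotp x x.
Proof. by apply: sumr_ge0 => i _; rewrite -expr2 sqr_ge0. Qed.

Lemma dotp_gt0 n (x : 'rV[R]_n) : x != 0 -> 0 < dotp x x.
Proof.
move=> x0; rewrite lt_neqAle dotp_ge0 andbT eq_sym; apply: contra x0 => /eqP x0.
apply/eqP/rowP => i; rewrite mxE; apply/eqP; rewrite -normr_le0.
by rewrite (le_trans (coord_enorm x i))// /enorm x0 sqrtr0.
Qed.

Lemma sqr_dist_continuous n (p : 'rV[R]_n) :
  continuous (fun q : 'rV[R]_n => dotp (p - q) (p - q)).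
Proof.
have cB i : continuous (fun q : 'rV[R]_n => (p - q) ord0 i).
  move=> q; apply: (@continuous_comp _ _ _ (fun q : 'rV[R]_n => p - q)
    (fun x => x ord0 i)); last exact: coord_continuous.
  by apply: (@cvgB _ _ _ (nbhs q)); [exact: cvg_cst|exact: cvg_id].
by apply: sum_continuous => i q; apply: (@cvgM R _ (nbhs q)); exact: cB.
Qed.

(** The first order optimality condition: used with a the derivative at t = 0 of
    half the decrease of a squared distance. *)
Lemma le0_of_linear_le_quadratic (a b : R) :
  (forall t, 0 < t < 1 -> 2 * t * a <= t ^+ 2 * b) -> a <= 0.
Proof.
move=> ab; rewrite leNgt; apply/negP => a0.
(* Small enough for t b <= a, the added 1 making t < 1. *)
pose t := a / (`|b| + a + 1).
have D0 : 0 < `|b| + a + 1 by have := normr_ge0 b; lra.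
have t0 : 0 < t by rewrite divr_gt0.
have t1 : t < 1 by rewrite ltr_pdivrMr// mul1r; have := normr_ge0 b; lra.
have := ab t; rewrite t0 t1 => /(_ isT).
rewrite -mulrA (mulrCA 2) expr2 -mulrA ler_pM2l// => tb.
have : t * b <= a.
  rewrite (le_trans (ler_wpM2l (ltW t0) (ler_norm b)))//.
  rewrite /t mulrAC ler_pdivrMr// ler_wpM2l ?ltW//; lra.
by move=> ?; lra.
Qed.

Lemma closure_stable (T : topologicalType) (C : set T) (g : T -> T) x :
  continuous g -> (forall c, C c -> C (g c)) -> closure C x -> closure C (g x).
Proof.
move=> cg gC Cx B /cg /Cx[y [Cy By]].
by exists (g y); split => //; exact: gC.
Qed.

(** The separating vector is l = p - q, with q the point of the closed cone
    nearest to p.  Moving from q in a direction c of the cone does not decrease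
    the distance, which gives l . c <= 0; shrinking q stays in the cone too, so
    l . (- q) <= 0 and l . p >= l . l > 0. *)
Lemma cone_separation n (C : set 'rV[R]_n) (p : 'rV[R]_n) :
  C 0 -> (forall x y, C x -> C y -> C (x + y)) ->
  (forall t x, 0 <= t -> C x -> C (t *: x)) ->
  ~ closure C p ->
  exists2 l, forall c, C c -> dotp l c <= 0 & 0 < dotp l p.
Proof.
move=> C0 CD CZ nCp.
pose f (q : 'rV[R]_n) := dotp (p - q) (p - q).
have cf : continuous f by exact: sqr_dist_continuous.
(* The minimum of f over the closed cone is searched where f does not exceed its
   value at the vertex 0; this part of the cone is compact. *)
pose A := closure C `&` [set q | f q <= f 0].
have A0 : A 0 by split => /=; [exact: subset_closure|].
have cA : compact A.
  apply: bounded_closed_compact.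
    pose M := enorm p + Num.sqrt (f 0).
    exists M; split => [|r Mr q [_ fq]]; first exact: num_real.
    have r0 : 0 <= r.
      by rewrite (le_trans _ (ltW Mr))// addr_ge0// sqrtr_ge0.
    rewrite /= [leLHS]mx_normrE; apply: bigmax_le => //= -[i j] _ /=.
    rewrite (ord1 i) (le_trans _ (ltW Mr))//.
    have -> : q ord0 j = p ord0 j - (p - q) ord0 j by rewrite !mxE subKr.
    rewrite (le_trans (ler_normB _ _))// lerD ?coord_enorm//.
    by rewrite (le_trans (coord_enorm _ _))// ler_wsqrtr.
  apply: closedI; first exact: closed_closure.
  apply: (@closed_comp _ _ f [set y | y <= f 0]); last exact: closed_le.
  by move=> q _; exact: cf.
have [q] : exists2 q, q \in A & forall t, t \in A -> f q <= f t.
  by apply: EVT_min_rV => //; [exists 0|exact: continuous_subspaceT].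
rewrite inE => -[Cq fq0] fq.
have {fq0}fq x : closure C x -> f q <= f x.
  move=> Cx; have [fx|/ltW fx] := leP (f x) (f 0); last exact: le_trans fx.
  by apply: fq; rewrite inE.
pose l := p - q.
have fqE t x : f (q + t *: x) = dotp (l - t *: x) (l - t *: x).
  by rewrite /f opprD addrA.
have opt x : (forall t, 0 < t < 1 -> closure C (q + t *: x)) -> dotp l x <= 0.
  move=> Cx; apply: (@le0_of_linear_le_quadratic _ (dotp x x)) => t t01.
  by have := fq _ (Cx t t01); rewrite fqE dotp_subZ {1}/f -/l; lra.
exists l => [c Cc|].
  apply: opt => t /andP[t0 _].
  apply: (@closure_stable _ C (fun x => x + t *: c)) => //.
    by move=> x; apply: (@cvgD _ _ _ (nbhs x)); [exact: cvg_id|exact: cvg_cst].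
  by move=> x Cx; apply: CD => //; apply: CZ => //; exact: ltW.
have lq : dotp l (- q) <= 0.
  apply: opt => t /andP[_ t1].
  rewrite scalerN -[X in X - _]scale1r -scalerBl.
  apply: (@closure_stable _ C (fun x => (1 - t) *: x)) => //.
    by move=> x; apply: (@cvgZl_tmp _ _ _ (nbhs x)); exact: cvg_id.
  by move=> x; apply: CZ; rewrite subr_ge0 ltW.
have l0 : l != 0.
  by apply: contra_notN nCp; rewrite subr_eq0 => /eqP ->.
have -> : p = l - - q by rewrite opprK subrK.
by rewrite dotpDr dotpNr; have := dotp_gt0 l0; lra.
Qed.

End separation.

(** * The bipolar theorem for weak* closures of convex cones *)

Section weak_star.
Context {R : realType} {V : normedModType R}.
Implicit Types (A : set (dual V)) (z : dual V).

Lemma weak_star_eval_continuous (x : V) :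
  continuous (fun z : weak_star_dual V => (z : dual V) x).
Proof.
move=> z; pose i := fun f : dual V => (f : V -> R) : {ptws V -> R}.
apply: (@continuous_comp (weak_star_dual V) {ptws V -> R} R i (fun g => g x)).
  exact: (@initial_continuous _ _ i).
exact: (@proj_continuous V (fun=> R) x).
Qed.

(** Neighbourhoods in the initial topology are preimages of neighbourhoods in the
    product topology, where convergence is pointwise. *)
Lemma cvg_weak_star (F : set_system (dual V)) z : Filter F ->
  (forall x, (fun w : dual V => w x) @ F --> z x) ->
  F --> (z : weak_star_dual V).
Proof.
move=> FF Fz; pose i := fun f : dual V => (f : V -> R) : {ptws V -> R}.
have iF : {ptws, i @ F --> (z : V -> R)}.
  by apply/pointwise_cvgP => x; exact: Fz.
move=> B [_ [[U oU <-] Uz] UB].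
apply: (@filterS _ F _ (i @^-1` U)) => //.
by apply: iF; apply: open_nbhs_nbhs; split.
Qed.

(** Finite lists of predual elements and tolerances index a filter base on A
    that converges pointwise to z. *)
Lemma weak_star_closure_approx A z :
  (forall (xs : seq V) (e : R), 0 < e ->
    exists2 w, A w & forall x, x \in xs -> `|w x - z x| < e) ->
  weak_star_closure A z.
Proof.
move=> Az; rewrite /weak_star_closure closureEcvg /=.
pose D := [set p : seq V * R | 0 < p.2].
pose B (p : seq V * R) :=
  A `&` [set w : dual V | forall x, x \in p.1 -> `|w x - z x| < p.2].
have FB : Filter (filter_from D B).
  apply: filter_from_filter; first by exists ([::], 1); rewrite /D /=.
  move=> [s e] [s' e'] /= e0 e'0.
  exists (s ++ s', Num.min e e'); first by rewrite /D /= lt_min e0.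
  move=> w [Aw /= wz]; split; split => //= x xs.
    have := wz x; rewrite mem_cat xs => /(_ isT).
    by rewrite lt_min => /andP[].
  have := wz x; rewrite mem_cat xs orbT => /(_ isT).
  by rewrite lt_min => /andP[].
exists (filter_from D B).
  apply: filter_from_proper => // -[s e] /= e0.
  by have [w Aw wz] := Az s e e0; exists w.
split; last by move=> S AS; exists ([::], 1); [rewrite /D /=|move=> w [/AS]].
apply: cvg_weak_star => x; apply/cvgrPdist_lt => e e0.
exists ([:: x], e) => // w [_ /=] /(_ x); rewrite mem_seq1 eqxx distrC.
exact.
Qed.

(** Evaluation at a finite list xs sends A to a convex cone of R^n.  If the image
    of z were not in its closure, the separating vector would be the coordinates
    of a combination of xs that contradicts the hypothesis. *)
Lemma weak_star_bipolar A z :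
  A 0 -> (forall v w, A v -> A w -> A (v + w)) ->
  (forall t w, 0 <= t -> A w -> A (t *: w)) ->
  (forall x, (forall w, A w -> w x <= 0) -> z x <= 0) ->
  weak_star_closure A z.
Proof.
move=> A0 AD AZ Az; apply: weak_star_closure_approx => xs e e0.
pose r (w : dual V) : 'rV[R]_(size xs) := \row_i w xs`_i.
have [rz|nrz] := pselect (closure (r @` A) (r z)).
  have [_ [[w Aw <-] [_ wz]]] := rz _ (nbhsx_ballx (r z) e e0).
  exists w => // x xxs.
  have i_lt : (index x xs < size xs)%N by rewrite index_mem.
  have := wz ord0 (Ordinal i_lt).
  by rewrite /ball /= !mxE /= nth_index// distrC.
have [l lA] : exists2 l,
    forall c, (r @` A) c -> dotp l c <= 0 & 0 < dotp l (r z).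
  apply: cone_separation nrz.
  - by exists 0 => //; apply/rowP => i; rewrite !mxE.
  - move=> _ _ [v Av <-] [w Aw <-]; exists (v + w); first exact: AD.
    by apply/rowP => i; rewrite !mxE.
  - move=> t _ t0 [w Aw <-]; exists (t *: w); first exact: AZ.
    by apply/rowP => i; rewrite !mxE.
have rE w : dotp l (r w) = w (\sum_i l ord0 i *: xs`_i).
  by rewrite linear_sum; apply: eq_bigr => i _; rewrite mxE linearZ.
rewrite rE ltNge Az// => w Aw.
by rewrite -rE lA//; exists w.
Qed.

End weak_star.

(** * Transposes and evaluations *)

Lemma dualB (R : realType) (V : normedModType R) (a : dual V) (x y : V) :
  a (x - y) = a x - a y.
Proof. exact: linearB. Qed.

Lemma dualZ (R : realType) (V : normedModType R) (a : dual V) (t : R) (x : V) :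
  a (t *: x) = t * a x.
Proof. exact: linearZ. Qed.

Section transpose.
Context {R : realType} {V W : normedModType R}.
Variables (f : V -> W) (lf : linear f) (k : R).
Hypothesis fk : forall x, `|f x| <= k * `|x|.

Lemma transpose_linear (a : dual W) : linear (fun x => a (f x)).
Proof. by move=> t x y; rewrite lf dual_linear. Qed.

Lemma transpose_bounded (a : dual W) x : `|a (f x)| <= `|a| * k * `|x|.
Proof.
rewrite (le_trans (dual_norm_le _ _))// -mulrA ler_wpM2l//.
exact: dual_norm_ge0.
Qed.

Definition transpose (a : dual W) : dual V :=
  mk_dual (transpose_linear a) (transpose_bounded a).

Lemma linear_transpose : linear transpose.
Proof. by move=> t a b; exact/val_inj/funext. Qed.

Hypothesis k0 : 0 <= k.

Lemma le_transpose (a : dual W) : `|transpose a| <= k * `|a|.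
Proof.
apply: dual_norm_leP; first by rewrite mulr_ge0.
by move=> x; rewrite (mulrC k); exact: transpose_bounded.
Qed.

End transpose.

Section evaluation.
Context {R : realType} {V : normedModType R}.

Lemma evaluation_linear (x : V) : linear (fun a : dual V => a x).
Proof. by []. Qed.

Lemma evaluation_bounded (x : V) (a : dual V) : `|a x| <= `|x| * `|a|.
Proof. by rewrite mulrC; exact: dual_norm_le. Qed.

Definition evaluation (x : V) : dual (dual V) :=
  mk_dual (evaluation_linear x) (evaluation_bounded x).

End evaluation.

Section pullback.
Context {R : realType} {S T : topologicalType}.
Variables (wS : weight R S) (wT : weight R T) (s : S -> T).
Hypothesis cs : continuous s.
Variable k : R.
Hypotheses (k0 : 0 <= k) (ws : forall x, wT (s x) <= k * wS x).

Lemma pullback_continuous (f : Cw wT) : continuous (fun x => f (s x)).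
Proof.
by move=> x; apply: continuous_comp; [exact: cs|exact: Cw_continuous].
Qed.

Lemma pullback_bounded (f : Cw wT) x : `|f (s x)| <= `|f| * k * wS x.
Proof.
rewrite (le_trans (Cw_norm_le _ _))// -mulrA ler_wpM2l//.
exact: Cw_norm_ge0.
Qed.

Lemma pullback_bound_ge0 (f : Cw wT) : 0 <= `|f| * k.
Proof. by rewrite mulr_ge0. Qed.

Definition pullback (f : Cw wT) : Cw wS :=
  mk_Cw (@pullback_continuous f) (pullback_bound_ge0 f) (pullback_bounded f).

Lemma linear_pullback : linear pullback.
Proof. by move=> t f g; exact/val_inj/funext. Qed.

Lemma le_pullback f : `|pullback f| <= k * `|f|.
Proof.
apply: Cw_norm_leP; first by rewrite mulr_ge0.
by move=> x; rewrite (mulrC k); exact: pullback_bounded.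
Qed.

Definition pushforward : dual (Cw wS) -> dual (Cw wT) :=
  transpose linear_pullback le_pullback.

(** The transpose of the transpose is taken directly on functionals:
    z |-> z o pushforward. *)
Definition bipullback : dual (dual (Cw wT)) -> dual (dual (Cw wS)) :=
  transpose (linear_transpose linear_pullback le_pullback)
    (le_transpose linear_pullback le_pullback k0).

End pullback.

Section positive.
Context {R : realType} {T : topologicalType} (w : weight R T).

(** The unit of an order unit space dominates: +/- f <= |f| u. *)
Lemma nonneg_dual_eq0 (a : dual (Cw w)) :
  dual_nonneg (@Cw_nonneg _ _ w) a -> a (Cw_unit w) <= 0 -> a = 0.
Proof.
move=> a0 au0; apply/val_inj/funext => f; apply/eqP.
have le_af (g : Cw w) : a g <= 0.
  have : 0 <= a (`|g| *: Cw_unit w - g).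
    apply: a0 => x; rewrite /= subr_ge0.
    by rewrite (le_trans (ler_norm _))// (le_trans (Cw_norm_le _ _)).
  rewrite linearB linearZ /= subr_ge0 => /le_trans; apply.
  by rewrite mulr_ge0_le0.
by rewrite eq_le le_af /= -oppr_le0 -linearN le_af.
Qed.

End positive.

(** * Prescribing the marginals of a martingale functional *)

Section martingale.
Context {R : realType} {d : nat}.
Local Notation E := 'rV[R]_d.
Implicit Types (a b : dual (Cw (@ell1 R d))) (eta : dual (Cw (@ell R d))).

Lemma affine_continuous (v : E) (k : R) : continuous (fun x => dotp v x + k).
Proof.
move=> x; apply: (@cvgD _ _ _ (nbhs x)); last exact: cvg_cst.
apply: sum_continuous => i y.
by apply: (@cvgZl_tmp _ _ _ (nbhs y)); exact: coord_continuous.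
Qed.

Lemma affine_bounded (v : E) (k : R) (x : E) :
  `|dotp v x + k| <= (\sum_i `|v ord0 i| + `|k|) * ell1 x.
Proof.
have x1 : 1 <= ell1 x by rewrite lerDl sqrtr_ge0.
rewrite (le_trans (ler_normD _ _))// mulrDl lerD//; last by rewrite ler_peMr.
rewrite (le_trans (ler_norm_sum _ _ _))// mulr_suml ler_sum// => i _.
rewrite normrM ler_wpM2l// (le_trans (coord_enorm x i))//.
by rewrite lerDr.
Qed.

Lemma affine_bound_ge0 (v : E) (k : R) : 0 <= \sum_i `|v ord0 i| + `|k|.
Proof. by rewrite addr_ge0// sumr_ge0. Qed.

Definition affine (v : E) (k : R) : Cw (@ell1 R d) :=
  mk_Cw (@affine_continuous v k) (affine_bound_ge0 v k) (@affine_bounded v k).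

(** The constant 1 is taken among the affine functions, so that functionals that
    agree on these have the same total mass. *)
Definition one : Cw (@ell1 R d) := affine 0 1.

Lemma oneE x : one x = 1.
Proof.
by rewrite /one /= /dotp big1 ?add0r// => i _; rewrite mxE mul0r.
Qed.

Definition agree_on_affine a b := forall v k, a (affine v k) = b (affine v k).

Lemma constant_bounded (v : E) : bounded_fun (fun _ : E => v).
Proof. by exists `|v|; split; [exact: num_real|move=> r /ltW vr x _]. Qed.

Definition constant (v : E) : @Cb R d :=
  MkCb (@cst_continuous E E v) (constant_bounded v).

(** A constant gamma = v gives T(v)(x, y) = v . x - v . y, and constants are the
    same whether seen as functions of x or of y. *)
Lemma mart_null_agree eta : mart_null eta ->
  agree_on_affine (marginX eta) (marginY eta).
Proof.
move=> eta0 v k; rewrite -[LHS]/(eta (oplus (affine v k) 0)).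
have -> : oplus (affine v k) 0 = Tmot (constant v) + oplus 0 (affine v k).
  apply/val_inj/funext => p.
  change (dotp v p.1 + k + 0 = dotp v (p.1 - p.2) + (0 + (dotp v p.2 + k))).
  by rewrite dotpDr dotpNr addr0 add0r addrA subrK.
by rewrite linearD/= eta0 add0r.
Qed.

Lemma diagonal_continuous : continuous (fun x : E => (x, x)).
Proof.
move=> x; apply: (@cvg_pair _ _ _ (nbhs x) (nbhs x) (nbhs x) _ _ _ id id);
  exact: cvg_id.
Qed.

Lemma slice_continuous : continuous (fun y : E => (0 : E, y)).
Proof.
move=> y.
by apply: (@cvg_pair _ _ _ (nbhs y) (nbhs (0 : E)) (nbhs y) _ _ _ (cst 0) id);
  [exact: cvg_cst|exact: cvg_id].
Qed.

Lemma ell_diagonal (x : E) : ell (x, x) <= 2 * ell1 x.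
Proof. by rewrite mulr_natl. Qed.

Lemma enorm0 : enorm (0 : E) = 0.
Proof.
by rewrite /enorm /dotp big1 ?sqrtr0// => i _; rewrite mxE mul0r.
Qed.

Lemma ell_slice (y : E) : ell (0 : E, y) <= 2 * ell1 y.
Proof.
rewrite mulr_natl mulr2n; apply: lerD => //=.
by rewrite enorm0 lerD// sqrtr_ge0.
Qed.

Definition from_diagonal : dual (Cw (@ell1 R d)) -> dual (Cw (@ell R d)) :=
  pushforward diagonal_continuous (ler0n _ 2) ell_diagonal.

Definition from_origin : dual (Cw (@ell1 R d)) -> dual (Cw (@ell R d)) :=
  pushforward slice_continuous (ler0n _ 2) ell_slice.

(** For measures: a placed on the diagonal plus b - a placed on {0} x R^d.  It is
    signed even for positive a and b, which is harmless since only annihilators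
    are at stake. *)
Definition coupling a b := from_diagonal a + from_origin (b - a).

Lemma couplingE a b f : coupling a b f =
  a (pullback diagonal_continuous (ler0n _ 2) ell_diagonal f) +
  (b (pullback slice_continuous (ler0n _ 2) ell_slice f) -
   a (pullback slice_continuous (ler0n _ 2) ell_slice f)).
Proof. by []. Qed.

(** T(gamma) is zero on the diagonal and linear in y on {0} x R^d. *)
Lemma coupling_mart_null a b : agree_on_affine a b -> mart_null (coupling a b).
Proof.
move=> ab gamma; rewrite couplingE.
have -> : pullback diagonal_continuous (ler0n _ 2) ell_diagonal (Tmot gamma) = 0.
  apply/val_inj/funext => x.
  change (dotp (gamma x) (x - x) = 0).
  by rewrite dotpDr dotpNr subrr.
have -> : pullback slice_continuous (ler0n _ 2) ell_slice (Tmot gamma) =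
    affine (- gamma 0) 0.
  apply/val_inj/funext => y.
  change (dotp (gamma 0) (0 - y) = dotp (- gamma 0) y + 0).
  by rewrite sub0r dotpNr addr0 [RHS]dotpC dotpNr dotpC.
by rewrite linear0 ab subrr addr0.
Qed.

(** On {0} x R^d a function of x is the constant h(0), on which a and b agree. *)
Lemma marginX_coupling a b : agree_on_affine a b ->
  marginX (coupling a b) = a.
Proof.
move=> ab; apply/val_inj/funext => h.
rewrite -[LHS]/(coupling a b (oplus h 0)) couplingE.
have -> : pullback diagonal_continuous (ler0n _ 2) ell_diagonal (oplus h 0) = h.
  by apply/val_inj/funext => x; exact: addr0.
have -> : pullback slice_continuous (ler0n _ 2) ell_slice (oplus h 0) =
    affine 0 (h 0).
  apply/val_inj/funext => y.
  change (h 0 + 0 = dotp 0 y + h 0).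
  by rewrite addr0 dotpC -(scale0r (0 : E)) dotpZr mul0r add0r.
by rewrite ab subrr addr0.
Qed.

Lemma marginY_coupling a b : marginY (coupling a b) = b.
Proof.
apply/val_inj/funext => g.
rewrite -[LHS]/(coupling a b (oplus 0 g)) couplingE.
have -> : pullback diagonal_continuous (ler0n _ 2) ell_diagonal (oplus 0 g) = g.
  by apply/val_inj/funext => x; exact: add0r.
have -> : pullback slice_continuous (ler0n _ 2) ell_slice (oplus 0 g) = g.
  by apply/val_inj/funext => x; exact: add0r.
by rewrite addrC subrK.
Qed.

Lemma oplus_split (h g : Cw (@ell1 R d)) : oplus h g = oplus h 0 + oplus 0 g.
Proof.
apply/val_inj/funext => p.
change (h p.1 + g p.2 = h p.1 + 0 + (0 + g p.2)).
by rewrite addr0 add0r.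
Qed.

(** * Moments and convex order *)

Section moments.
Variables (mu : probability (borel_type E) R) (imu : finite_first_moment mu).

Lemma moment_functional_one : moment_functional imu one = 1.
Proof.
rewrite -[LHS]/(\int[mu]_(x in [set: borel_type E]) one x).
rewrite (_ : (fun x => _) = cst 1); last by apply/funext => x; exact: oneE.
by rewrite Rintegral_cst// mul1r; exact: (congr1 fine (probability_setT mu)).
Qed.

Lemma EFin_moment_functional (h : Cw (@ell1 R d)) :
  (moment_functional imu h)%:E =
  (\int[mu]_(x in [set: borel_type E]) (h x)%:E)%E.
Proof.
by rewrite [LHS]fineK//; apply: integrable_fin_num => //;
  exact: (Cw_integrable (ell1_integrable imu)).
Qed.

End moments.

Lemma affine_convex (v : E) (k : R) :
  convex_function [set: E] (affine v k).
Proof.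
move=> t x y _ _.
rewrite /affine /=.
change (dotp v (t%:num *: x + (1 - t%:num) *: y) + k <=
  t%:num * (dotp v x + k) + (1 - t%:num) * (dotp v y + k)).
by rewrite dotpDr !dotpZr; lra.
Qed.

(** Affine functions and their opposites are both convex. *)
Lemma convex_order_agree (mu nu : probability (borel_type E) R)
    (imu : finite_first_moment mu) (inu : finite_first_moment nu) :
  convex_order mu nu ->
  agree_on_affine (moment_functional imu) (moment_functional inu).
Proof.
move=> munu.
have le_mn v k : moment_functional imu (affine v k) <=
    moment_functional inu (affine v k).
  rewrite -lee_fin !EFin_moment_functional; apply: munu.
  exact: affine_convex.
move=> v k; apply/eqP; rewrite eq_le le_mn /= -lerN2.
have affN : - affine v k = affine (- v) (- k).
  apply/val_inj/funext => x.
  change (- (dotp v x + k) = dotp (- v) x - k).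
  by rewrite opprD (dotpC (- v)) dotpNr (dotpC x).
by have := le_mn (- v) (- k); rewrite -affN !linearN.
Qed.

(** * The annihilator of H_mot and its bidual annihilator *)

Section problem.
Variables (mu nu : probability (borel_type E) R).
Hypotheses (imu : finite_first_moment mu) (inu : finite_first_moment nu).
Hypothesis munu : convex_order mu nu.
Local Notation Mu := (moment_functional imu).
Local Notation Nu := (moment_functional inu).

Lemma annihilator_HmotI eta (s t : R) : mart_null eta ->
  marginX eta = s *: Mu -> marginY eta = t *: Nu ->
  annihilator (Hmot mu nu) eta.
Proof.
move=> eta0 etax etay _ [h [g [gamma [muh nug ->]]]].
rewrite linearD/= eta0 addr0 oplus_split linearD/=.
rewrite -[eta (oplus h 0)]/(marginX eta h) -[eta (oplus 0 g)]/(marginY eta g).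
rewrite etax etay -[LHS]/(s * Mu h + t * Nu g).
by rewrite [Mu h]muh [Nu g]nug !mulr0 addr0.
Qed.

Lemma annihilator_Hmot_mart_null eta : annihilator (Hmot mu nu) eta ->
  mart_null eta.
Proof.
move=> etaH gamma.
have <- : oplus 0 0 + Tmot gamma = Tmot gamma.
  apply/val_inj/funext => p.
  change (0 + 0 + Tmot gamma p = Tmot gamma p).
  by rewrite !add0r.
apply: etaH; exists 0, 0, gamma; split => //.
- exact: (linear0 Mu).
- exact: (linear0 Nu).
Qed.

Lemma annihilator_Hmot_margins eta (h g : Cw (@ell1 R d)) :
  annihilator (Hmot mu nu) eta -> Mu h = 0 -> Nu g = 0 ->
  marginX eta h + marginY eta g = 0.
Proof.
move=> etaH muh nug.
rewrite -[LHS]/(eta (oplus h 0) + eta (oplus 0 g)) -linearD -oplus_split.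
have -> : oplus h g = oplus h g + Tmot (constant 0).
  apply/val_inj/funext => p.
  change (h p.1 + g p.2 = h p.1 + g p.2 + dotp 0 (p.1 - p.2)).
  by rewrite dotpC -(scale0r (0 : E)) dotpZr mul0r addr0.
by apply: etaH; exists h, g, (constant 0).
Qed.

(** Subtracting its mu-mean from h makes it admissible in H_mot. *)
Lemma annihilator_Hmot_marginX eta : annihilator (Hmot mu nu) eta ->
  marginX eta = marginX eta one *: Mu.
Proof.
move=> etaH; apply/val_inj/funext => h; apply/eqP.
rewrite -[X in _ == X]/(marginX eta one * Mu h) mulrC -subr_eq0.
rewrite -[Mu h * _]/(Mu h *: marginX eta one) -linearZ -linearB.
rewrite -[X in X == _]addr0 -(linear0 (marginY eta)).
rewrite annihilator_Hmot_margins ?linear0//.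
by rewrite dualB dualZ moment_functional_one mulr1 subrr.
Qed.

Lemma annihilator_Hmot_marginY eta : annihilator (Hmot mu nu) eta ->
  marginY eta = marginY eta one *: Nu.
Proof.
move=> etaH; apply/val_inj/funext => g; apply/eqP.
rewrite -[X in _ == X]/(marginY eta one * Nu g) mulrC -subr_eq0.
rewrite -[Nu g * _]/(Nu g *: marginY eta one) -linearZ -linearB.
rewrite -[X in X == _]add0r -(linear0 (marginX eta)).
rewrite annihilator_Hmot_margins ?linear0//.
by rewrite dualB dualZ moment_functional_one mulr1 subrr.
Qed.

Lemma coupling_annihilator_Hmot : annihilator (Hmot mu nu) (coupling Mu Nu).
Proof.
have agree := convex_order_agree imu inu munu.
apply: (@annihilator_HmotI _ 1 1).
- exact: coupling_mart_null.
- by rewrite marginX_coupling// scale1r.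
- by rewrite marginY_coupling scale1r.
Qed.

(** The residual has zero marginals. *)
Lemma coupling_residual eta : mart_null eta ->
  annihilator (Hmot mu nu) (eta - coupling (marginX eta) (marginY eta)).
Proof.
move=> eta0; have agree := mart_null_agree eta0.
have couple0 := coupling_mart_null agree.
apply: (@annihilator_HmotI _ 0 0).
- move=> gamma.
  rewrite -[LHS]/(eta (Tmot gamma) - coupling _ _ (Tmot gamma)).
  by rewrite eta0 couple0 subr0.
- rewrite scale0r -[RHS](subrr (marginX eta)) -{3}(marginX_coupling agree).
  exact/val_inj/funext.
- rewrite scale0r -[RHS](subrr (marginY eta)).
  rewrite -{3}(marginY_coupling (marginX eta) (marginY eta)).
  exact/val_inj/funext.
Qed.

Local Notation sumBCM :=
  (minkowski_sum (minkowski_sum (frakB imu) (frakC inu)) (@frakM R d)).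

Lemma sumBCM_frakHmot : sumBCM `<=` frakHmot mu nu.
Proof.
move=> _ [_ [_ [b bmu <-] [_ [c cnu <-] <-]] [m mM <-]] eta etaH.
rewrite /mkset in bmu cnu.
rewrite -[LHS]/(b (marginX eta) + 0 + (0 + c (marginY eta)) + m eta).
rewrite mM; last exact: annihilator_Hmot_mart_null.
rewrite (annihilator_Hmot_marginX etaH) (annihilator_Hmot_marginY etaH).
by rewrite !dualZ bmu cnu !mulr0 !addr0.
Qed.

Definition bipull_diagonal : dual (dual (Cw (@ell R d))) ->
    dual (dual (Cw (@ell1 R d))) :=
  bipullback diagonal_continuous (ler0n _ 2) ell_diagonal.
Definition bipull_origin : dual (dual (Cw (@ell R d))) ->
    dual (dual (Cw (@ell1 R d))) :=
  bipullback slice_continuous (ler0n _ 2) ell_slice.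

(** The summands are z composed with the two pieces of the coupling, up to a
    multiple of the total mass that restores b(mu) = c(nu) = 0. *)
Lemma frakHmot_sumBCM : frakHmot mu nu `<=` sumBCM.
Proof.
move=> z zH.
pose c0 := bipull_origin z.
pose b0 := bipull_diagonal z - c0.
have zcoupling a b : z (coupling a b) = b0 a + c0 b.
  rewrite -[RHS]/(z (from_diagonal a) - z (from_origin a) + z (from_origin b)).
  rewrite /coupling (_ : from_origin (b - a) = from_origin b - from_origin a).
    by rewrite linearD linearB/= addrCA [in RHS]addrC.
  exact/val_inj/funext.
pose s := b0 Mu.
(* Convex order enters here: the coupling of mu and nu is in N because they have
   the same barycentre. *)
have cs : c0 Nu = - s.
  apply/eqP; rewrite -addr_eq0 addrC -zcoupling; apply/eqP.
  exact/zH/coupling_annihilator_Hmot.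
pose b := b0 - s *: evaluation one.
pose c := c0 + s *: evaluation one.
have bc eta : mart_null eta -> z eta = b (marginX eta) + c (marginY eta).
  move=> /[dup] /coupling_residual/zH/eqP.
  rewrite linearB/= subr_eq0 => /eqP -> /mart_null_agree agree.
  rewrite zcoupling.
  rewrite -[RHS]/(b0 (marginX eta) - s * marginX eta one +
    (c0 (marginY eta) + s * marginY eta one)).
  by rewrite agree addrACA addNr addr0.
exists (bioplus b 0 + bioplus 0 c).
  exists (bioplus b 0).
    exists b => //=.
    by rewrite -[LHS]/(s - s * Mu one) moment_functional_one mulr1 subrr.
  exists (bioplus 0 c) => //; exists c => //=.
  by rewrite -[LHS]/(c0 Nu + s * Nu one) cs moment_functional_one mulr1 addNr.
exists (z - (bioplus b 0 + bioplus 0 c)); last by rewrite addrC subrK.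
move=> eta /bc zeta.
rewrite -[LHS]/(z eta - (b (marginX eta) + 0 + (0 + c (marginY eta)))).
by rewrite addr0 add0r zeta subrr.
Qed.

Lemma frakHmot_eq : frakHmot mu nu = sumBCM.
Proof.
by rewrite eqEsubset; split; [exact: frakHmot_sumBCM|exact: sumBCM_frakHmot].
Qed.

(** * The dual cone K_mot *)

Lemma frakHmot_nonpos_frakKmot :
  minkowski_sum (frakHmot mu nu) (@bidual_nonpos R d) `<=` frakKmot mu nu.
Proof.
move=> _ [z zH [w w0 <-]] eta [etaH [eta0 _]].
by rewrite -[leLHS]/(z eta + w eta) zH// add0r w0.
Qed.

(** K_mot is an intersection of weak* closed half-spaces. *)
Lemma weak_star_closure_frakKmot A : A `<=` frakKmot mu nu ->
  weak_star_closure A `<=` frakKmot mu nu.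
Proof.
move=> AK z Az eta Qeta.
have cl : closed [set w : weak_star_dual (dual (Cw (@ell R d))) |
    (w : dual (dual (Cw (@ell R d)))) eta <= 0].
  apply: (@closed_comp _ _ (fun w : weak_star_dual (dual (Cw (@ell R d))) =>
    (w : dual (dual (Cw (@ell R d)))) eta) [set y | y <= 0]).
    by move=> w _; exact: weak_star_eval_continuous.
  exact: closed_le.
by apply: cl; apply: closureS Az => w /AK; exact.
Qed.

(** By the bipolar theorem it suffices to test z on the polar cone of the sum,
    which consists of the nonnegative multiples of the elements that define
    K_mot. *)
Lemma frakKmot_closure : frakKmot mu nu `<=`
  weak_star_closure (minkowski_sum (frakHmot mu nu) (@bidual_nonpos R d)).
Proof.
move=> z zK; apply: weak_star_bipolar.
- exists 0 => //; exists 0; last exact: addr0.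
  by move=> eta _.
- move=> _ _ [z1 z1H [w1 w10 <-]] [z2 z2H [w2 w20 <-]].
  exists (z1 + z2).
    by move=> eta etaH; rewrite -[LHS]/(z1 eta + z2 eta) z1H// z2H// addr0.
  exists (w1 + w2); last exact: addrACA.
  move=> eta eta0; rewrite -[leLHS]/(w1 eta + w2 eta) -[leRHS]addr0.
  by rewrite lerD ?w10 ?w20.
- move=> t _ t0 [z1 z1H [w1 w10 <-]].
  exists (t *: z1).
    by move=> eta etaH; rewrite -[LHS]/(t * z1 eta) z1H// mulr0.
  exists (t *: w1); last by rewrite scalerDr.
  by move=> eta eta0; rewrite -[leLHS]/(t * w1 eta) mulr_ge0_le0// w10.
move=> eta eta_le0.
(* Evaluations at elements of H_mot and their multiples of either sign belong to
   the annihilator of N. *)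
have etaH : annihilator (Hmot mu nu) eta.
  have le_etaH (k : R) f : Hmot mu nu f -> k * eta f <= 0.
    move=> Hf; apply: (eta_le0 (k *: evaluation f)).
    exists (k *: evaluation f).
      by move=> eta' eta'H; rewrite -[LHS]/(k * eta' f) eta'H// mulr0.
    by exists 0; [move=> eta' _|exact: addr0].
  move=> f Hf; apply/eqP; rewrite eq_le -{1}(mul1r (eta f)) le_etaH//=.
  by rewrite -oppr_le0 -mulN1r le_etaH.
have eta0 : dual_nonneg (@Cw_nonneg _ _ (@ell R d)) eta.
  move=> f f0; rewrite -oppr_le0.
  apply: (eta_le0 (- evaluation f)).
  exists 0; first by move=> eta' _.
  exists (- evaluation f); last exact: add0r.
  by move=> eta' eta'0; rewrite -[leLHS]/(- eta' f) oppr_le0 eta'0.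
have [eta1|eta1] := leP (eta (Cw_unit (@ell R d))) 0.
  by rewrite (nonneg_dual_eq0 eta0 eta1) linear0.
set l := eta _ in eta1.
have : z (l^-1 *: eta) <= 0.
  apply: zK; split.
    by move=> f Hf; rewrite -[LHS]/(l^-1 * eta f) etaH// mulr0.
  split => [f f0|].
    rewrite -[leRHS]/(l^-1 * eta f) mulr_ge0//; last exact: eta0.
    by rewrite invr_ge0 ltW.
  by rewrite -[LHS]/(l^-1 * l) mulVf// gt_eqF.
by rewrite linearZ /= pmulr_rle0// invr_gt0.
Qed.

End problem.

End martingale.

Theorem theorem8p2 (R : realType) (d : nat)
    (mu nu : probability (borel_type 'rV[R]_d) R)
    (imu : finite_first_moment mu) (inu : finite_first_moment nu)
    (munu : convex_order mu nu) :
  frakHmot mu nu = minkowski_sum (minkowski_sum (frakB imu) (frakC inu)) frakM /\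
  frakKmot mu nu =
    weak_star_closure
      (minkowski_sum
        (minkowski_sum (minkowski_sum (frakB imu) (frakC inu)) frakM)
        bidual_nonpos).
Proof.
have HE := frakHmot_eq imu inu munu; split => //.
rewrite -HE eqEsubset; split; first exact: frakKmot_closure.
exact/weak_star_closure_frakKmot/frakHmot_nonpos_frakKmot.
Qed.
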